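(* Let $m\ge 2$, $n\ge 1$ be integers and let $\mathcal{A}\in\mathbb{T}_{m,n}$ be a strong P-tensor. Then for every $b\in\mathbb{R}^n$ the system of tensor equations $\mathcal{A}x^{m-1}=b$ has a unique solution $x\in\mathbb{R}^n$.
   Context: $\mathbb{T}_{m,n}$ denotes the set of all $m$-th order $n$-dimensional square real tensors $\mathcal{A}=(a_{i_1i_2\cdots i_m})$, $i_1,\ldots,i_m\in\{1,\ldots,n\}$. For $\mathcal{A}\in\mathbb{T}_{m,n}$ and $x\in\mathbb{R}^n$, $\mathcal{A}x^{m-1}\in\mathbb{R}^n$ is the vector with components $(\mathcal{A}x^{m-1})_i=\sum_{i_2,\ldots,i_m=1}^n a_{ii_2\cdots i_m}x_{i_2}\cdots x_{i_m}$, $i=1,\ldots,n$. A tensor $\mathcal{A}\in\mathbb{T}_{m,n}$ is a strong P-tensor if $\max_{1\le i\le n}(x_i-y_i)(\mathcal{A}x^{m-1}-\mathcal{A}y^{m-1})_i>0$ for all $x,y\in\mathbb{R}^n$ with $x\ne y$. *)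

(* Defs.v *)
From mathcomp Require Import all_boot all_order all_algebra.
From mathcomp Require Import reals constructive_ereal.

Set Implicit Arguments.
Unset Strict Implicit.
Unset Printing Implicit Defensive.

Import Order.TTheory GRing.Theory Num.Theory.

Local Open Scope ring_scope.

Definition tensor (R : realType) (m n : nat) := {ffun m.-tuple 'I_n -> R}.

(* The i-th component sums over the index tuples (i_1, ..., i_m) with i_1 = i;
   [behead J] is (i_2, ..., i_m). *)
Definition tensor_app (R : realType) (m n : nat) (A : tensor R m n)
    (x : 'rV[R]_n) : 'rV[R]_n :=
  \row_i \sum_(J : m.-tuple 'I_n | ohead J == Some i)
           A J * \prod_(j <- behead J) x 0 j.

(* The maximum is taken in the extended reals so that the neutral element -oo
   does not affect its value when 0 < n. *)
Definition strong_P_tensor (R : realType) (m n : nat) (A : tensor R m n) : Prop :=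
  forall x y : 'rV[R]_n, x <> y ->
    (0%:E < \big[maxe/-oo]_(i < n)
       ((x 0 i - y 0 i) * (tensor_app A x - tensor_app A y) 0 i)%:E)%E.

(* Main.v *)
(* Uniqueness is immediate from the P property. For existence put
   F(x) = A x^(m-1). Since F is homogeneous of positive degree and
   max_i x_i F_i(x) > 0 on the unit sphere, F is coercive: |x| is bounded as soon
   as each coordinate satisfies |x_i| <= B, |F_i(x)| <= B or x_i F_i(x) <= 0.
   By induction on #|J|, the mixed system "F_i(x) = b_i for i in J, x_i = t_i for
   i not in J" is then solvable for all b and t: removing j from J leaves
   a curve K of solutions, one for each value of x_j, along which F_j increases
   with x_j, and coercivity makes F_j - b_j change sign on K.
   The theorem is the case where J is the whole index set. *)

Require Import Defs.
From mathcomp Require Import all_boot all_order all_algebra.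
From mathcomp Require Import reals constructive_ereal.
From mathcomp Require Import boolp classical_sets topology normedtype derive.
From mathcomp Require Import lra.

Import Order.TTheory GRing.Theory Num.Theory numFieldNormedType.Exports.

Local Open Scope ring_scope.

Lemma le_coord_mx_norm (R : realType) (n : nat) (x : 'rV[R]_n) (i : 'I_n) :
  `|x 0 i| <= `|x|.
Proof.
by rewrite [leRHS]/Num.norm /= mx_normrE; apply/bigmax_geP; right; exists (0, i).
Qed.

Lemma continuous_bigmax (R : realType) (n : nat) (T : topologicalType)
    (f : 'I_n -> T -> R) :
  (forall i, continuous (f i)) ->
  continuous (fun x => \big[Num.max/0]_(i < n) f i x).
Proof.
move=> cf; apply: continuous_big => [p|i _]; last exact: cf.
by apply: (@continuous_max _ _ fst snd); [exact: cvg_fst|exact: cvg_snd].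
Qed.

(** * P maps and coercivity *)

Definition P_map (R : realType) (n : nat) (F : 'rV[R]_n -> 'rV[R]_n) : Prop :=
  forall x y : 'rV[R]_n, x <> y -> exists i, 0 < (x 0 i - y 0 i) * (F x 0 i - F y 0 i).

(* Contrapositively: outside a ball, some i has x_i F_i(x) > 0 with both factors
   large in absolute value. *)
Definition P_coercive (R : realType) (n : nat) (F : 'rV[R]_n -> 'rV[R]_n) :
    Prop :=
  forall B : R, 0 <= B -> exists M : R, forall x : 'rV[R]_n,
    (forall i, [\/ `|x 0 i| <= B, `|F x 0 i| <= B | x 0 i * F x 0 i <= 0]) ->
    `|x| <= M.

(** Comparing [x] with 0 makes the largest x_i F_i(x) positive on the unit sphere; compactness makes
    it uniformly so. *)
Lemma P_map_sphere (R : realType) (n : nat) (F : 'rV[R]_n -> 'rV[R]_n) :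
  (forall i, continuous (fun x => F x 0 i)) -> F 0 = 0 -> P_map R n F ->
  exists d C : R, [/\ 0 < d, 0 <= C & forall x : 'rV[R]_n, `|x| = 1 ->
    (exists i, d <= x 0 i * F x 0 i) /\ forall i, `|F x 0 i| <= C].
Proof.
move=> cF F0 PF; set S := [set x : 'rV[R]_n | `|x| = 1]%classic.
(* The sphere is empty when n = 0. *)
have [[x0 Sx0]|S0] := pselect (S !=set0)%classic; last first.
  by exists 1, 0; split=> // x x1; case: S0; exists x.
have cS : compact S.
  apply: bounded_closed_compact.
    by exists 1; split=> // M M1 x /= ->; exact: ltW.
  by apply: (preimage_closed _ (@closed_eq R 1)) => x _; exact: norm_continuous.
have S0 : (S !=set0)%classic by exists x0.
have cf i : continuous (fun x : 'rV[R]_n => x 0 i * F x 0 i).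
  by move=> x; apply: continuousM; [exact: coord_continuous|exact: cF].
have cg i : continuous (fun x : 'rV[R]_n => `|F x 0 i|).
  by move=> x; exact: (continuous_comp (cF i x) (@norm_continuous R R^o _)).
have [u /set_mem Su umin] :=
  EVT_min_rV S0 cS (continuous_subspaceT (continuous_bigmax R n _ _ cf)).
have [v /set_mem Sv vmax] :=
  EVT_max_rV S0 cS (continuous_subspaceT (continuous_bigmax R n _ _ cg)).
pose d := \big[Num.max/0]_(i < n) (u 0 i * F u 0 i); have d0 : 0 < d.
  have [|i] := PF u 0.
    by move=> u0; move: Su; rewrite /S/= u0 normr0 => /eqP; rewrite eq_sym oner_eq0.
  rewrite F0 !mxE !subr0 => ui; apply: (lt_le_trans ui).
  by apply/bigmax_geP; right; exists i.
exists d, (\big[Num.max/0]_(i < n) `|F v 0 i|); split=> //.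
  exact: bigmax_ge_id.
move=> x x1; split=> [|i].
  (* As [d] is positive, the default 0 of the maximum cannot account for it, so a genuine index
     does. *)
  have /bigmax_geP[|[i _ xi]] := umin x (mem_set x1); last by exists i.
  by rewrite leNgt d0.
by apply: le_trans (vmax x (mem_set x1)); apply/bigmax_geP; right; exists i.
Qed.

Lemma homogeneous_P_coercive (R : realType) (n k : nat)
    (F : 'rV[R]_n -> 'rV[R]_n) :
  (forall i, continuous (fun x => F x 0 i)) ->
  (forall (a : R) (x : 'rV[R]_n), F (a *: x) = a ^+ k.+1 *: F x) -> P_map R n F ->
  P_coercive R n F.
Proof.
move=> cF hF PF.
have F0 : F 0 = 0 by have := hF 0 0; rewrite scaler0 expr0n scale0r.
have [d [C [d0 C0 dC]]] := P_map_sphere R n F cF F0 PF.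
(* Write x = r u with |u| = 1 and pick i with u_i F_i(u) >= d. The summands cover, in turn, r <= 1,
   then |x_i| <= B, where r d <= B C, then |F_i(x)| <= B with r >= 1, where r d <= B. The sign
   alternative fails at i. *)
move=> B B0; exists (1 + B * C / d + B / d) => x hx.
have BCd : 0 <= B * C / d by rewrite divr_ge0 ?mulr_ge0 // ltW.
have Bd : 0 <= B / d by rewrite divr_ge0 // ltW.
have [->|xN0] := eqVneq x 0; first by rewrite normr0 !addr_ge0.
have r0 : 0 < `|x| by rewrite normr_gt0.
set r := `|x| in r0 *.
have [u u1 xE] : exists2 u : 'rV[R]_n, `|u| = 1 & x = r *: u.
  exists (r^-1 *: x); last by rewrite scalerA mulfV ?gt_eqF// scale1r.
  by rewrite normrZ gtr0_norm ?invr_gt0// mulVf ?gt_eqF.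
have [[i di] Cu] := dC u u1; have ui1 := le_coord_mx_norm R n u i.
rewrite u1 in ui1; have dn : d <= `|u 0 i| * `|F u 0 i|.
  by rewrite -normrM; apply: le_trans di (ler_norm _).
case: (hx i); rewrite xE ?hF !mxE.
- rewrite normrM gtr0_norm// => ruB.
  suff : r <= B * C / d by lra.
  rewrite ler_pdivlMr//; apply: (le_trans (ler_wpM2l (ltW r0) dn)).
  by rewrite mulrA ler_pM// mulr_ge0// ltW.
- rewrite normrM gtr0_norm ?exprn_gt0// => ruB.
  have [r1|/ltW r1] := leP r 1; first by lra.
  suff : r <= B / d by lra.
  rewrite ler_pdivlMr//; apply: le_trans ruB; apply: ler_pM => //.
  - exact: ltW.
  - exact: ltW.
  - by rewrite exprS ler_peMr ?exprn_ege1// ltW.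
  - by apply: (le_trans dn); rewrite ler_piMl.
- by rewrite mulrACA leNgt pmulr_rgt0 ?(lt_le_trans d0 di)// mulr_gt0 ?exprn_gt0.
Qed.

(** * Surjectivity of coercive P maps *)

Section P_map_onto.
Variables (R : realType) (n : nat) (F : 'rV[R]_n -> 'rV[R]_n).
Hypotheses (cF : forall i, continuous (fun x => F x 0 i)).
Hypotheses (PF : P_map R n F) (coF : P_coercive R n F).

(** An index outside both [D] and [J] stays free, so solution curves are covered. *)
Let mixed (D J : {set 'I_n}) (t b : 'rV[R]_n) (x : 'rV[R]_n) : Prop :=
  forall i, (i \in D -> x 0 i = t 0 i) /\ (i \in J -> F x 0 i = b 0 i).

Lemma closed_mixed D J t b : closed (mixed D J t b).
Proof.
have -> : mixed D J t b =
    ((\bigcap_(i in [set i | i \in D]) (fun x : 'rV[R]_n => x 0 i) @^-1`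
        [set a | a = t 0 i]) `&`
     (\bigcap_(i in [set i | i \in J]) (fun x : 'rV[R]_n => F x 0 i) @^-1`
        [set a | a = b 0 i]))%classic.
  apply/seteqP; split=> x /= => [h|[h1 h2] i].
    by split=> i /=; have [] := h i.
  by split; [exact: h1|exact: h2].
apply: closedI; apply: closed_bigI => i _; apply: preimage_closed;
  try exact: closed_eq; move=> x _.
- exact: coord_continuous.
- exact: cF.
Qed.

Lemma P_map_mixed (J : {set 'I_n}) (t b : 'rV[R]_n) :
  exists x : 'rV[R]_n, forall i, if i \in J then F x 0 i = b 0 i else x 0 i = t 0 i.
Proof.
move: {2}#|J| (erefl #|J|) t b => p; elim: p J => [|p IH] J cJ t b.
  by exists t => i; rewrite (cards0_eq cJ) inE.
have /card_gt0P[j jJ] : (0 < #|J|)%N by rewrite cJ.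
have {cJ} cJ : #|J :\ j| = p by move: cJ; rewrite (cardsD1 j) jJ => -[].
pose K := mixed (~: J) (J :\ j) t b.
have curve s : exists2 x, K x & x 0 j = s.
  have [x hx] := IH _ cJ (\row_i if i == j then s else t 0 i) b.
  exists x; last by have := hx j; rewrite !inE eqxx/= mxE eqxx.
  move=> i; have := hx i; rewrite !inE; case: eqVneq => [->|ij] /=.
    by rewrite jJ.
  by rewrite mxE (negbTE ij); case: ifP.
(* Only the j-th coordinate can witness the P property on K, so x_j and F_j are
   strictly comonotone along K. *)
have mono x y : K x -> K y -> x <> y -> 0 < (x 0 j - y 0 j) * (F x 0 j - F y 0 j).
  move=> Kx Ky /PF[i]; have [->//|ij] := eqVneq i j.
  have [[x1 x2] [y1 y2]] := (Kx i, Ky i).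
  have [iJ|iJ] := boolP (i \in J).
    by rewrite x2 ?y2 ?inE ?ij// subrr mulr0 ltxx.
  by rewrite x1 ?y1 ?inE// subrr mul0r ltxx.
(* [B] bounds all prescribed data, so on [K] the coercivity alternatives need checking only at
   [j]. *)
pose B := `|t| + `|b|.
have B0 : 0 <= B by rewrite addr_ge0.
have tB i : `|t 0 i| <= B by rewrite (le_trans (le_coord_mx_norm _ _ _ i)) ?lerDl.
have bB i : `|b 0 i| <= B by rewrite (le_trans (le_coord_mx_norm _ _ _ i)) ?lerDr.
have coK B' : B <= B' -> exists M, forall x, K x ->
    [\/ `|x 0 j| <= B', `|F x 0 j| <= B' | x 0 j * F x 0 j <= 0] -> `|x| <= M.
  move=> BB'; have [M hM] := coF B' (le_trans B0 BB').
  exists M => x Kx xj; apply: hM => i; have [->//|ij] := eqVneq i j.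
  have [x1 x2] := Kx i; have [iJ|iJ] := boolP (i \in J).
    by apply: Or32; rewrite x2 ?inE ?ij// (le_trans (bB i)).
  by apply: Or31; rewrite x1 ?inE// (le_trans (tB i)).
have [M hM] := coK B (lexx B).
pose S := `|M| + 1.
have MS : M < S by rewrite ltr_pwDr// ler_norm.
have S0 : 0 < S by rewrite ltr_wpDl.
(* Here |x| >= S > M, so the alternatives fail at [j]: x_j F_j > 0 and |F_j| > B >= |b_j|, hence F_j
   - b_j has the sign of x_j. *)
have far x : K x -> `|x 0 j| = S -> 0 < x 0 j * (F x 0 j - b 0 j).
  move=> Kx xS; rewrite ltNge; apply/negP => xF.
  have : `|x| <= M.
    apply: hM => //; have [FB|BF] := leP `|F x 0 j| B; first exact: Or32.
    apply: Or33; rewrite leNgt; apply/negP => xF0.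
    move: xF; apply/negP; rewrite -ltNge mulrBr subr_gt0.
    apply: le_lt_trans (ler_norm _) _; rewrite -[ltRHS]gtr0_norm// !normrM xS.
    by rewrite ltr_pM2l// (le_lt_trans (bB j)).
  by rewrite leNgt (lt_le_trans MS)// -xS le_coord_mx_norm.
have BS : B <= B + S by rewrite lerDl ltW.
(* A second use of coercivity, with a threshold at least [S], bounds the part of [K] where |x_j| <=
   S. *)
have [N hN] := coK (B + S) BS.
pose slab := [set x | K x /\ `|x 0 j| <= S]%classic.
have cslab : compact slab.
  apply: bounded_closed_compact.
    exists N; split=> [|N' NN' x [Kx xS]]; first exact: num_real.
    by apply: (le_trans (hN x Kx _) (ltW NN')); apply: Or31; rewrite ler_wpDl.
  apply: closedI; first exact: closed_mixed.
  apply: (preimage_closed _ (@closed_le R S)) => x _.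
  exact: (continuous_comp (@coord_continuous R 1 n 0 j x) (@norm_continuous R R^o _)).
pose lo := (slab `&` [set x | F x 0 j <= b 0 j])%classic.
pose hi := (slab `&` [set x | b 0 j <= F x 0 j])%classic.
have clo : compact lo.
  apply: compact_closedI => //.
  by apply: (preimage_closed _ (@closed_le R (b 0 j))) => x _; exact: cF.
have chi : compact hi.
  apply: compact_closedI => //.
  by apply: (preimage_closed _ (@closed_ge R (b 0 j))) => x _; exact: cF.
have cj : continuous (fun x : 'rV[R]_n => x 0 j) by exact: coord_continuous.
(* The last point of K with F_j <= b_j and the first one with F_j >= b_j
   coincide; compactness thus replaces the continuity of the curve K. *)
have [x /set_mem[[Kx xS] xb] xmax] :
    exists2 x, x \in lo & forall y, y \in lo -> y 0 j <= x 0 j.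
  apply: EVT_max_rV clo (continuous_subspaceT cj).
  have [x Kx xS] := curve (- S); have xS' : `|x 0 j| = S.
    by rewrite xS normrN gtr0_norm.
  exists x; split; first by split=> //; rewrite xS'.
  have := far x Kx xS'; rewrite xS mulNr oppr_gt0 pmulr_rlt0// subr_lt0.
  exact: ltW.
have [y /set_mem[[Ky yS] yb] ymin] :
    exists2 y, y \in hi & forall x, x \in hi -> y 0 j <= x 0 j.
  apply: EVT_min_rV chi (continuous_subspaceT cj).
  have [y Ky yS] := curve S; have yS' : `|y 0 j| = S.
    by rewrite yS gtr0_norm.
  exists y; split; first by split=> //; rewrite yS'.
  by have := far y Ky yS'; rewrite yS pmulr_rgt0// subr_gt0 => /ltW.
(* Otherwise the point of [K] with midway j-th coordinate lies in [lo] or [hi] and contradicts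
   extremality. *)
have yx : y 0 j <= x 0 j.
  rewrite leNgt; apply/negP => xy.
  have [z Kz zE] := curve ((x 0 j + y 0 j) / 2).
  have zS : `|z 0 j| <= S.
    by move: xS yS; rewrite zE !ler_norml => /andP[? ?] /andP[? ?]; apply/andP; lra.
  have [zb|bz] := leP (F z 0 j) (b 0 j).
    by have := xmax z; rewrite inE => /(_ (conj (conj Kz zS) zb)); lra.
  by have := ymin z; rewrite inE => /(_ (conj (conj Kz zS) (ltW bz))); lra.
(* Now x_j >= y_j but F_j(x) <= b_j <= F_j(y), against strict comonotonicity unless the points
   agree. *)
have xyE : x = y.
  apply: contrapT => /(mono x y Kx Ky); apply/negP; rewrite -leNgt.
  by rewrite mulr_ge0_le0 ?subr_ge0// subr_le0 (le_trans xb).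
exists x => i; case: ifPn => iJ; last by have [+ _] := Kx i; rewrite inE iJ; apply.
have [->|ij] := eqVneq i j; last by have [_ +] := Kx i; rewrite !inE ij iJ; apply.
by apply/le_anti; rewrite xb xyE yb.
Qed.

Lemma P_map_onto b : exists x : 'rV[R]_n, F x = b.
Proof.
have [x hx] := P_map_mixed [set: 'I_n] 0 b; exists x; apply/rowP => i.
by have := hx i; rewrite inE.
Qed.

End P_map_onto.

(** * Tensor maps as homogeneous P maps *)

Lemma tensor_appZ (R : realType) (m n : nat) (A : tensor R m n) (a : R)
    (x : 'rV[R]_n) : tensor_app A (a *: x) = a ^+ m.-1 *: tensor_app A x.
Proof.
apply/rowP => i; rewrite !mxE big_distrr; apply: eq_bigr => J _ /=.
under eq_bigr do rewrite mxE.
rewrite big_split /= big_const_seq iter_mulr_1 count_predT size_behead.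
by rewrite size_tuple mulrCA.
Qed.

Lemma tensor_app_continuous (R : realType) (m n : nat) (A : tensor R m n)
    (i : 'I_n) : continuous (fun x => tensor_app A x 0 i).
Proof.
have -> : (fun x : 'rV[R]_n => tensor_app A x 0 i) =
    (fun x => \sum_(J : m.-tuple 'I_n | ohead J == Some i)
      A J * \prod_(j <- behead J) x 0 j) by apply: funext => x; rewrite mxE.
apply: continuous_big => [|J _]; first exact: add_continuous.
move=> x; apply: continuousM; first exact: cst_continuous.
apply: (continuous_big (@mul_continuous R)) => j _; exact: coord_continuous.
Qed.

Lemma strong_P_tensor_P_map (R : realType) (m n : nat) (A : tensor R m n) :
  strong_P_tensor A -> P_map R n (tensor_app A).
Proof.
move=> hA x y /hA; rewrite ltNge => /negP H; apply: contrapT => /forallNP noi.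
apply: H; apply/bigmax_leP; split=> [|i _]; first exact: leNye.
by rewrite lee_fin leNgt; apply/negP; have := noi i; rewrite !mxE.
Qed.

Theorem theorem3p5 (R : realType) (m n : nat) (hm : (2 <= m)%N) (hn : (1 <= n)%N)
    (A : tensor R m n) (hA : strong_P_tensor A) :
  forall b : 'rV[R]_n, exists! x : 'rV[R]_n, tensor_app A x = b.
Proof.
move=> b; have PA := strong_P_tensor_P_map R m n A hA.
have cA := tensor_app_continuous R m n A.
have coA : P_coercive R n (tensor_app A).
  (* The degree m - 1 is the successor of m - 2 because m >= 2. *)
  apply: (homogeneous_P_coercive R n m.-2) => // a x.
  by rewrite tensor_appZ prednK ?ltn_predRL.
have [x xb] := P_map_onto R n _ cA PA coA b.
exists x; split=> // y yb; apply: contrapT => /PA[i].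
by rewrite xb yb subrr mulr0 ltxx.
Qed.
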